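(* Let $g$ be a piecewise $D$-finite function on $[a,b]$ with $K\ge0$ jump points $\xi_1<\dots<\xi_K$ in $(a,b)$ and pieces $g_0,\dots,g_K$, and let $\mathfrak{D}=\sum_{j=0}^Np_j(x)\partial^j$ be a differential operator of order $N$ with polynomial coefficients that annihilates every piece of $g$. Then the entire function $g$ is annihilated as a distribution by the operator $$\widehat{\mathfrak{D}}=\prod_{i=1}^{K}(x-\xi_i)^N\cdot\mathfrak{D},$$ that is, $\langle\widehat{\mathfrak{D}}g,f\rangle=0$ for every test function $f\in C^{N-1}([a,b])$.
   Context: Setting. $-\infty<a=\xi_0<\xi_1<\dots<\xi_{K+1}=b<\infty$, $\Delta_n=[\xi_n,\xi_{n+1}]$; $g:[a,b]\to\mathbb{R}$ equals $g_n\in C^N(\Delta_n)$ on $\Delta_n$ with $\mathfrak{D}g_n\equiv0$ on $\Delta_n$, $0\le n\le K$; $\partial=d/dx$, $N\ge1$, and the $p_j$ are real polynomials with $p_N(x)\ne0$ for all $x\in[a,b]$. Each $g_n$ is extended to all of $[a,b]$ as a solution of $\mathfrak{D}u=0$. The function $g$ is identified with the distribution $g(x)=\widetilde g_0(x)+\sum_{n=1}^K\widetilde g_n(x)\mathcal{H}(x-\xi_n)$, where $\widetilde g_n=g_n-g_{n-1}$, $g_{-1}\equiv0$, and $\mathcal{H}(x)=0$ for $x<0$, $\mathcal{H}(x)=1$ for $x\ge0$. Derivatives are distributional derivatives on the open interval $(a,b)$, with $\mathcal{H}'=\delta$. The distributions that arise are sums of an ordinary piecewise continuous function $r$ and finitely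 many terms $c(x)\delta^{(l)}(x-\xi_i)$ with $0\le l\le N-1$ and $c$ sufficiently differentiable at $\xi_i$; the pairing of such a distribution with $f\in C^{N-1}([a,b])$ is $\int_a^brf\,dx$ plus the corresponding terms $\langle c\,\delta^{(l)}(x-\xi_i),f\rangle=(-1)^l(cf)^{(l)}(\xi_i)$. *)

(* Defs.v *)
From Stdlib Require Import Reals Lra Lia List.
From Coquelicot Require Import Coquelicot.
Open Scope R_scope.

(* a = xi 0 < xi 1 < ... < xi (K+1) = b; only the indices 0, ..., K+1 matter. *)
Definition is_partition (a b : R) (K : nat) (xi : nat -> R) : Prop :=
  xi 0%nat = a /\ xi (S K) = b /\
  forall n, (n <= K)%nat -> xi n < xi (S n).

Definition is_polynomial (q : R -> R) : Prop :=
  exists (d : nat) (c : nat -> R),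
    forall x, q x = sum_n (fun k => c k * x ^ k) d.

Definition itv (c d x : R) : Prop := c <= x <= d.

(* U 0, ..., U k are u and its derivatives up to order k on the closed interval
   [c, d], all continuous there.  D_in and continue_in are relative to [c, d],
   so derivatives at the end points are one-sided and the values of u and U
   outside [c, d] play no role. *)
Definition derivatives_on (c d : R) (k : nat) (u : R -> R) (U : nat -> R -> R)
  : Prop :=
  (forall x, itv c d x -> U 0%nat x = u x) /\
  (forall j, (j < k)%nat ->
     forall x, itv c d x -> D_in (U j) (U (S j)) (itv c d) x) /\
  (forall x, itv c d x -> continue_in (U k) (itv c d) x).

Definition Cn_on (c d : R) (k : nat) (u : R -> R) : Prop :=
  exists U, derivatives_on c d k u U.

(* u is in C^N([c, d]) and sum_(j <= N) p_j u^(j) vanishes on [c, d]. *)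
Definition is_solution_on (c d : R) (N : nat) (p : nat -> R -> R) (u : R -> R)
  : Prop :=
  exists U, derivatives_on c d N u U /\
    forall x, itv c d x -> sum_n (fun j => p j x * U j x) N = 0.

Definition heaviside (x : R) : R := if Rle_dec 0 x then 1 else 0.

Definition jump (g : nat -> R -> R) (n : nat) (x : R) : R :=
  match n with
  | O => g 0%nat x
  | S m => g n x - g m x
  end.

(* On [xi n, xi (n+1)) the sum telescopes to g n (see glueE), so the values
   of g n outside [xi n, xi (n+1)], in particular the way in which g n is
   continued to the rest of [a, b], do not matter. *)
Definition glue (K : nat) (xi : nat -> R) (g : nat -> R -> R) (x : R) : R :=
  jump g 0 x + sum_n_m (fun n => jump g n x * heaviside (x - xi n)) 1 K.

Definition is_test (a b : R) (phi : R -> R) : Prop :=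
  (forall n x, ex_derive_n phi n x) /\
  exists c d, a < c /\ d < b /\ forall x, phi x <> 0 -> c <= x <= d.

(* A distribution on (a, b) is represented by its action on functions; only
   the values on functions satisfying is_test are meaningful. *)
Definition dist := (R -> R) -> R.

Definition dist_of_fun (a b : R) (r : R -> R) : dist :=
  fun phi => RInt (fun x => r x * phi x) a b.

Definition dist_derive (T : dist) : dist := fun phi => - T (Derive phi).

Definition dist_mult (q : R -> R) (T : dist) : dist :=
  fun phi => T (fun x => q x * phi x).

Definition diff_op (N : nat) (p : nat -> R -> R) (T : dist) : dist :=
  fun phi =>
    sum_n (fun j => dist_mult (p j) (Nat.iter j dist_derive T) phi) N.

Definition jump_factor (K N : nat) (xi : nat -> R) (x : R) : R :=
  fold_right Rmult 1 (map (fun i => (x - xi i) ^ N) (seq 1 K)).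

Definition hat_op (K N : nat) (xi : nat -> R) (p : nat -> R -> R) (T : dist)
  : dist :=
  dist_mult (jump_factor K N xi) (diff_op N p T).

Definition piecewise_continuous (a b : R) (r : R -> R) : Prop :=
  exists (m : nat) (t : nat -> R), is_partition a b m t /\
    forall i, (i <= m)%nat ->
      exists h, Cn_on (t i) (t (S i)) 0 h /\
        forall x, t i < x < t (S i) -> r x = h x.

(* The expression c(x) delta^(l)(x - xi_i). *)
Record delta_term := DeltaTerm {
  dt_coef : R -> R;
  dt_order : nat;
  dt_index : nat
}.

(* The expression r + (finite sum of delta terms). *)
Record delta_sum := DeltaSum {
  ds_fun : R -> R;
  ds_terms : list delta_term
}.

Definition delta_term_ok (K N : nat) (xi : nat -> R) (t : delta_term) : Prop :=
  (dt_order t <= N - 1)%nat /\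
  (1 <= dt_index t <= K)%nat /\
  locally (xi (dt_index t))
    (fun y => forall k, (k <= dt_order t)%nat -> ex_derive_n (dt_coef t) k y).

Definition delta_sum_ok (a b : R) (K N : nat) (xi : nat -> R) (s : delta_sum)
  : Prop :=
  piecewise_continuous a b (ds_fun s) /\
  List.Forall (delta_term_ok K N xi) (ds_terms s).

Definition delta_term_pair (xi : nat -> R) (f : R -> R) (t : delta_term) : R :=
  (-1) ^ dt_order t *
  Derive_n (fun x => dt_coef t x * f x) (dt_order t) (xi (dt_index t)).

Definition delta_sum_pair (a b : R) (xi : nat -> R) (s : delta_sum)
  (f : R -> R) : R :=
  RInt (fun x => ds_fun s x * f x) a b +
  fold_right Rplus 0 (map (delta_term_pair xi f) (ds_terms s)).

Definition represents (a b : R) (K N : nat) (xi : nat -> R) (s : delta_sum)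
  (T : dist) : Prop :=
  delta_sum_ok a b K N xi s /\
  forall phi, is_test a b phi -> T phi = delta_sum_pair a b xi s phi.

(* <T, f> = v for f in C^(N-1)([a, b]), which need not be a test function:
   the distribution T on (a, b) is of the form r + (delta terms), and <T, f>
   is computed from such an expression.  The value is required to be v for
   every expression of T, so that it does not depend on the one chosen. *)
Definition dist_pairing (a b : R) (K N : nat) (xi : nat -> R) (T : dist)
  (f : R -> R) (v : R) : Prop :=
  (exists s, represents a b K N xi s T) /\
  forall s, represents a b K N xi s T -> delta_sum_pair a b xi s f = v.

Lemma is_partition_le (a b : R) (K : nat) (xi : nat -> R) (m n : nat) :
  is_partition a b K xi -> (m <= n <= S K)%nat -> xi m <= xi n.
Proof.
intros (_ & _ & Hlt) [Hmn HnK].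
induction Hmn as [|n Hmn IH]; [lra|].
assert (H := Hlt n ltac:(lia)).
assert (xi m <= xi n) by (apply IH; lia).
lra.
Qed.

Lemma glueE (a b : R) (K : nat) (xi : nat -> R) (g : nat -> R -> R)
  (n : nat) (x : R) :
  is_partition a b K xi -> (n <= K)%nat -> xi n <= x < xi (S n) ->
  glue K xi g x = g n x.
Proof.
intros Hxi HnK Hx.
assert (H : forall k, (k <= K)%nat ->
  glue k xi g x = g (Nat.min k n) x).
{ intros k; induction k as [|k IH]; intros Hk; unfold glue in *.
  - rewrite sum_n_m_zero by lia. unfold zero; simpl. ring.
  - rewrite sum_n_Sm by lia. unfold plus; simpl plus.
    change (jump g 0 x + (sum_n_m (fun n0 => jump g n0 x
      * heaviside (x - xi n0)) 1 k + jump g (S k) x * heaviside (x - xi (S k)))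
      = g (Nat.min (S k) n) x).
    rewrite <- Rplus_assoc, IH by lia. unfold heaviside.
    destruct (Nat.le_gt_cases (S k) n) as [Hkn|Hkn].
    + assert (H := is_partition_le a b K xi (S k) n Hxi ltac:(lia)).
      destruct (Rle_dec 0 (x - xi (S k))); [|lra].
      rewrite (Nat.min_l (S k) n), (Nat.min_l k n) by lia. simpl. ring.
    + assert (H := is_partition_le a b K xi (S n) (S k) Hxi ltac:(lia)).
      destruct (Rle_dec 0 (x - xi (S k))); [lra|].
      rewrite (Nat.min_r (S k) n), (Nat.min_r k n) by lia. ring. }
rewrite H by lia. now rewrite Nat.min_r by lia.
Qed.

(* Main.v *)
(**
The factor (x - xi_i)^N kills every jump: for a test function phi, the function
prod_i (x - xi_i)^N phi vanishes to order N at all xi_i, and near a and b, so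
integrating by parts j <= N times on each piece leaves no boundary terms and
moves the derivatives onto g_n, where D g_n = 0.

To pair with a function f that is only C^(N-1), take any expression
r + (delta terms) that pairs to 0 with all test functions.  Small bump
functions supported off the xi_i show that r = 0 off a finite set, and the delta
terms see only the derivatives of order < N at the xi_i, which are also those of
some test function (Hermite interpolation).
*)

Require Import Defs.
From Stdlib Require Import Reals Lra Lia List Factorial.
From Coquelicot Require Import Coquelicot.
Open Scope R_scope.

(** * Functions differentiable near a point *)

(** A neighbourhood and all orders up to [n] are involved because this is the form in which
    [Derive_n] is additive, and because [delta_term_ok] states it for coefficients. *)
Definition diff_near (n : nat) (f : R -> R) (x : R) : Prop :=
  locally x (fun y => forall k, (k <= n)%nat -> ex_derive_n f k y).

Lemma Derive_n_Derive (f : R -> R) (n : nat) (x : R) :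
  Derive_n (Derive f) n x = Derive_n f (S n) x.
Proof.
rewrite <- Nat.add_1_r. exact (Derive_n_comp f n 1 x).
Qed.

(** The shift starts at order two: [ex_derive_n (Derive f) 0] is [True], while [ex_derive_n f 1]
    asks for a derivative. *)
Lemma ex_derive_n_SS (f : R -> R) (n : nat) (x : R) :
  ex_derive_n f (S (S n)) x <-> ex_derive_n (Derive f) (S n) x.
Proof.
split; apply ex_derive_ext; intros t; [symmetry|]; apply Derive_n_Derive.
Qed.

Lemma diff_near_S (n : nat) (f : R -> R) (x : R) :
  diff_near (S n) f x <->
  locally x (fun y => ex_derive f y) /\ diff_near n (Derive f) x.
Proof.
split.
- unfold diff_near; intros H; split; revert H; apply filter_imp; intros y Hy.
  + exact (Hy 1%nat ltac:(lia)).
  + intros [|k] Hk; [exact I|].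
    apply (proj1 (ex_derive_n_SS f k y)), Hy; lia.
- intros [H1 H2]; unfold diff_near in *.
  generalize (filter_and _ _ H1 H2).
  apply filter_imp; intros y [Hy1 Hy2] [|[|k]] Hk; [exact I|exact Hy1|].
  apply (proj2 (ex_derive_n_SS f k y)), Hy2; lia.
Qed.

Lemma diff_near_0 (f : R -> R) (x : R) : diff_near 0 f x.
Proof.
exists (mkposreal 1 Rlt_0_1); intros y _ k Hk.
now replace k with 0%nat by lia.
Qed.

Lemma diff_near_le (m n : nat) (f : R -> R) (x : R) :
  (m <= n)%nat -> diff_near n f x -> diff_near m f x.
Proof.
intros Hmn; unfold diff_near; apply filter_imp; intros y Hy k Hk. apply Hy; lia.
Qed.

Lemma diff_near_ext (n : nat) (f g : R -> R) (x : R) :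
  locally x (fun y => f y = g y) -> diff_near n f x -> diff_near n g x.
Proof.
intros Hfg Hf; unfold diff_near in *.
generalize (filter_and _ _ (locally_locally _ _ Hfg) Hf).
apply filter_imp; intros y [Hy1 Hy2] k Hk.
apply ex_derive_n_ext_loc with f; auto.
Qed.

Lemma diff_near_plus (n : nat) (f g : R -> R) (x : R) :
  diff_near n f x -> diff_near n g x -> diff_near n (fun y => f y + g y) x.
Proof.
intros Hf Hg; unfold diff_near in *.
generalize (filter_and _ _ (locally_locally _ _ Hf) (locally_locally _ _ Hg)).
apply filter_imp; intros y [Hy1 Hy2] k Hk.
apply ex_derive_n_plus; now apply diff_near_le with n.
Qed.

Lemma diff_near_minus (n : nat) (f g : R -> R) (x : R) :
  diff_near n f x -> diff_near n g x -> diff_near n (fun y => f y - g y) x.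
Proof.
intros Hf Hg; unfold diff_near in *.
generalize (filter_and _ _ (locally_locally _ _ Hf) (locally_locally _ _ Hg)).
apply filter_imp; intros y [Hy1 Hy2] k Hk.
apply ex_derive_n_minus; now apply diff_near_le with n.
Qed.

Lemma locally_Derive_mult (f g : R -> R) (x : R) :
  locally x (fun y => ex_derive f y) -> locally x (fun y => ex_derive g y) ->
  locally x (fun y => Derive (fun t => f t * g t) y
                      = Derive f y * g y + f y * Derive g y).
Proof.
intros Hf Hg; generalize (filter_and _ _ Hf Hg).
apply filter_imp; intros y [Hy1 Hy2]. now apply Derive_mult.
Qed.

(** Induction on the order with the product rule for a single derivative; the factors are
    generalized because either may become its own derivative. *)
Lemma diff_near_mult (n : nat) (f g : R -> R) (x : R) :
  diff_near n f x -> diff_near n g x -> diff_near n (fun y => f y * g y) x.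
Proof.
revert f g; induction n as [|n IH]; intros f g Hf Hg; [apply diff_near_0|].
assert (Hf' := diff_near_le n (S n) f x ltac:(lia) Hf).
assert (Hg' := diff_near_le n (S n) g x ltac:(lia) Hg).
apply diff_near_S in Hf; destruct Hf as [Hf1 Hf2].
apply diff_near_S in Hg; destruct Hg as [Hg1 Hg2].
apply diff_near_S; split.
- generalize (filter_and _ _ Hf1 Hg1); apply filter_imp; intros y [Hy1 Hy2].
  now apply @ex_derive_mult.
- apply diff_near_ext with (fun y => Derive f y * g y + f y * Derive g y).
  + generalize (locally_Derive_mult f g x Hf1 Hg1); apply filter_imp.
    intros y Hy; now symmetry.
  + apply diff_near_plus; now apply IH.
Qed.

(** One differentiation gives [c' u + c u'], and both [u] and [u'] have vanishing derivatives up to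
    one order less, so the full Leibniz formula is avoided. *)
Lemma Derive_n_mult_zero_jet (n : nat) (c u : R -> R) (x : R) :
  diff_near n c x -> diff_near n u x ->
  (forall k, (k <= n)%nat -> Derive_n u k x = 0) ->
  Derive_n (fun y => c y * u y) n x = 0.
Proof.
revert c u; induction n as [|n IH]; intros c u Hc Hu H0.
- simpl. rewrite (H0 0%nat (le_n _) : u x = 0). ring.
- assert (Hc' := diff_near_le n (S n) c x ltac:(lia) Hc).
  assert (Hu' := diff_near_le n (S n) u x ltac:(lia) Hu).
  apply diff_near_S in Hc; destruct Hc as [Hc1 Hc2].
  apply diff_near_S in Hu; destruct Hu as [Hu1 Hu2].
  rewrite <- Derive_n_Derive.
  rewrite (Derive_n_ext_loc _ _ n x (locally_Derive_mult c u x Hc1 Hu1)).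
  rewrite Derive_n_plus; [|now apply diff_near_mult..].
  rewrite IH; [rewrite IH; [ring|..]|..]; auto.
  intros k Hk; rewrite Derive_n_Derive; apply H0; lia.
Qed.

(** * Smooth functions on the line and their orders of vanishing *)

Definition smooth (f : R -> R) : Prop := forall n x, ex_derive_n f n x.

Lemma smooth_diff_near (f : R -> R) (n : nat) (x : R) :
  smooth f -> diff_near n f x.
Proof.
intros Hf. exists (mkposreal 1 Rlt_0_1); intros y _ k _. apply Hf.
Qed.

Lemma diff_near_smooth (f : R -> R) :
  (forall n x, diff_near n f x) -> smooth f.
Proof.
intros H n x. now apply (locally_singleton _ _ (H n x)).
Qed.

Lemma smooth_ext (f g : R -> R) :
  (forall x, f x = g x) -> smooth f -> smooth g.
Proof.
intros Hfg Hf n x. now apply ex_derive_n_ext with f.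
Qed.

Lemma smooth_plus (f g : R -> R) :
  smooth f -> smooth g -> smooth (fun x => f x + g x).
Proof.
intros Hf Hg; apply diff_near_smooth; intros n x.
apply diff_near_plus; now apply smooth_diff_near.
Qed.

Lemma smooth_mult (f g : R -> R) :
  smooth f -> smooth g -> smooth (fun x => f x * g x).
Proof.
intros Hf Hg; apply diff_near_smooth; intros n x.
apply diff_near_mult; now apply smooth_diff_near.
Qed.

Lemma smooth_const (c : R) : smooth (fun _ => c).
Proof. intros n x; apply ex_derive_n_const. Qed.

Lemma smooth_pow_trans (c : R) (n : nat) : smooth (fun x => (x - c) ^ n).
Proof.
intros k x. apply (ex_derive_n_comp_trans (fun y => y ^ n) k x (- c)).
apply ex_derive_n_pow.
Qed.

Lemma smooth_polynomial (q : R -> R) : is_polynomial q -> smooth q.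
Proof.
intros (d & c & Hq).
apply smooth_ext with (fun x => sum_n (fun k => c k * x ^ k) d);
  [intros; now symmetry|].
intros n x; apply ex_derive_n_sum_n.
exists (mkposreal 1 Rlt_0_1); intros y _ l j _ _.
apply ex_derive_n_scal_l, ex_derive_n_pow.
Qed.

Lemma smooth_Derive (f : R -> R) : smooth f -> smooth (Derive f).
Proof.
intros Hf [|n] x; [exact I|]. exact (proj1 (ex_derive_n_SS f n x) (Hf _ x)).
Qed.

Lemma smooth_Derive_n (f : R -> R) (n : nat) : smooth f -> smooth (Derive_n f n).
Proof.
intros Hf; induction n as [|n IH]; [exact Hf|]. exact (smooth_Derive _ IH).
Qed.

Lemma smooth_is_derive (f : R -> R) (x : R) :
  smooth f -> is_derive f x (Derive f x).
Proof. intros Hf. exact (Derive_correct _ _ (Hf 1%nat x)). Qed.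

Lemma smooth_continuous (f : R -> R) (x : R) : smooth f -> continuous f x.
Proof.
intros Hf. apply @ex_derive_continuous. exact (Hf 1%nat x).
Qed.

(** A derivative uses up one factor [y - c] and leaves a smooth cofactor whose value at [c] is
    [INR (S n) * h c]. This drives both inductions on the order of vanishing below. *)
Lemma Derive_pow_mult (c : R) (n : nat) (h : R -> R) (x : R) :
  smooth h ->
  Derive (fun y => (y - c) ^ S n * h y) x =
  (x - c) ^ n * (INR (S n) * h x + (x - c) * Derive h x).
Proof.
intros Hh. apply is_derive_unique.
auto_derive; [exact (Hh 1%nat x)|].
change (Derive (fun x0 => h x0) x) with (Derive h x).
(* The [match] is [INR (S n)] in unfolded form. *)
change (match n with 0%nat => 1 | S _ => INR n + 1 end) with (INR (S n)).
unfold Rminus; generalize ((x + - c) ^ n) (INR (S n)); intros; ring.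
Qed.

Lemma smooth_Derive_pow_cofactor (c a : R) (h : R -> R) :
  smooth h -> smooth (fun x => a * h x + (x - c) * Derive h x).
Proof.
intros Hh; apply smooth_plus; apply smooth_mult; auto.
- apply smooth_const.
- apply smooth_ext with (fun x => (x - c) ^ 1); [intros; ring|].
  apply smooth_pow_trans.
- now apply smooth_Derive.
Qed.

Lemma Derive_n_pow_mult_lt (c : R) (n k : nat) (h : R -> R) :
  smooth h -> (k < n)%nat -> Derive_n (fun y => (y - c) ^ n * h y) k c = 0.
Proof.
revert k h; induction n as [|n IH]; intros k h Hh Hk; [lia|].
destruct k as [|k]; [simpl; ring|].
rewrite <- Derive_n_Derive.
erewrite Derive_n_ext; [|intros t; now apply Derive_pow_mult].
apply IH; [|lia]. now apply smooth_Derive_pow_cofactor.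
Qed.

(** The value is [n!] times [h c]; the induction only tracks that the cofactor stays non-zero at
    [c]. *)
Lemma Derive_n_pow_mult_neq (c : R) (n : nat) (h : R -> R) :
  smooth h -> h c <> 0 -> Derive_n (fun y => (y - c) ^ n * h y) n c <> 0.
Proof.
revert h; induction n as [|n IH]; intros h Hh Hc; [simpl; lra|].
rewrite <- Derive_n_Derive.
erewrite Derive_n_ext; [|intros t; now apply Derive_pow_mult].
apply IH; [now apply smooth_Derive_pow_cofactor|].
replace (c - c) with 0 by ring. rewrite Rmult_0_l, Rplus_0_r.
apply Rmult_integral_contrapositive_currified; [|exact Hc].
apply not_0_INR; lia.
Qed.

Lemma Derive_n_locally_zero (f : R -> R) (k : nat) (x : R) :
  locally x (fun y => f y = 0) -> Derive_n f k x = 0.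
Proof.
intros H. rewrite (Derive_n_ext_loc f (fun _ => 0) k x H).
destruct k; [reflexivity|]. apply Derive_n_const.
Qed.

(** * Bump functions *)

(* The powers of 1/x make the family closed under differentiation, see
   [is_derive_exp_inv]. *)
Definition exp_inv (n : nat) (x : R) : R :=
  if Rlt_dec 0 x then (/ x) ^ n * exp (- / x) else 0.

(** [y ^ n / n!] is one term of the exponential series, whose terms are all non-negative for
    [y > 0]. *)
Lemma pow_mult_exp_opp_le (n : nat) (y : R) :
  0 < y -> y ^ n * exp (- y) <= INR (fact n).
Proof.
intros Hy.
assert (Hf := INR_fact_lt_0 n).
assert (H := exp_ge_taylor y n ltac:(lra)).
assert (H1 : y ^ n / INR (fact n) <= exp y).
{ eapply Rle_trans; [|exact H]. destruct n as [|n]; [simpl; lra|].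
  rewrite tech5. rewrite <- (Rplus_0_l (_ / _)) at 1.
  apply Rplus_le_compat_r, cond_pos_sum. intros k.
  apply Rmult_le_pos; [apply pow_le; lra|].
  apply Rlt_le, Rinv_0_lt_compat, INR_fact_lt_0. }
rewrite exp_Ropp. assert (He := exp_pos y).
apply Rmult_le_reg_r with (exp y); [exact He|].
rewrite Rmult_assoc, Rinv_l, Rmult_1_r by lra.
apply Rmult_le_reg_r with (/ INR (fact n)); [now apply Rinv_0_lt_compat|].
replace (INR (fact n) * exp y * / INR (fact n)) with (exp y) by (field; lra).
exact H1.
Qed.

(** The previous bound at [/ x] with exponent [n + 2]: the two spare powers give [x ^ 2], which
    forces a zero derivative at the origin. *)
Lemma exp_inv_sqr_bound (n : nat) (x : R) :
  Rabs (exp_inv n x) <= INR (fact (S (S n))) * x ^ 2.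
Proof.
unfold exp_inv. destruct (Rlt_dec 0 x) as [Hx|Hx].
- assert (H := pow_mult_exp_opp_le (S (S n)) (/ x) (Rinv_0_lt_compat _ Hx)).
  rewrite Rabs_pos_eq.
  + replace ((/ x) ^ n * exp (- / x))
      with ((/ x) ^ S (S n) * exp (- / x) * x ^ 2) by (simpl; field; lra).
    apply Rmult_le_compat_r; [apply pow2_ge_0|exact H].
  + apply Rmult_le_pos; [|apply Rlt_le, exp_pos].
    apply pow_le, Rlt_le, Rinv_0_lt_compat, Hx.
- rewrite Rabs_R0. apply Rmult_le_pos; [apply pos_INR|apply pow2_ge_0].
Qed.

Lemma is_derive_exp_inv (n : nat) (x : R) :
  is_derive (exp_inv n) x
    (- INR n * exp_inv (S n) x + exp_inv (S (S n)) x).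
Proof.
destruct (Rtotal_order x 0) as [Hx|[Hx|Hx]].
- apply is_derive_ext_loc with (fun _ => 0).
  + apply filter_imp with (fun y => y < 0); [|now apply open_lt].
    intros y Hy; unfold exp_inv; destruct (Rlt_dec 0 y); [lra|easy].
  + unfold exp_inv; destruct (Rlt_dec 0 x); [lra|].
    replace (- INR n * 0 + 0) with 0 by ring. apply @is_derive_const.
- subst x. apply is_derive_Reals. intros eps Heps.
  set (C := INR (fact (S (S n)))).
  assert (HC : 0 < C) by apply INR_fact_lt_0.
  (* The difference quotient at 0 is at most [C * Rabs t], hence this radius. *)
  assert (Hd : 0 < eps / C) by (now apply Rdiv_lt_0_compat).
  exists (mkposreal _ Hd); intros t Ht Htd; simpl in Htd.
  assert (H0 : forall m, exp_inv m 0 = 0).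
  { intros m; unfold exp_inv; destruct (Rlt_dec 0 0); [lra|easy]. }
  rewrite !H0, Rplus_0_l.
  replace ((exp_inv n t - 0) / t - (- INR n * 0 + 0))
    with (exp_inv n t / t) by (field; exact Ht).
  unfold Rdiv; rewrite Rabs_mult, Rabs_inv.
  assert (Hp := Rabs_pos_lt t Ht).
  apply Rle_lt_trans with (C * Rabs t).
  + apply Rmult_le_reg_r with (Rabs t); [exact Hp|].
    rewrite Rmult_assoc, Rinv_l, Rmult_1_r by lra.
    replace (C * Rabs t * Rabs t) with (C * t ^ 2)
      by (rewrite <- (pow2_abs t); ring).
    apply exp_inv_sqr_bound.
  + apply Rmult_lt_compat_l with (r := C) in Htd; [|exact HC].
    replace (C * (eps / C)) with eps in Htd by (field; lra). exact Htd.
- apply is_derive_ext_loc with (fun y => (/ y) ^ n * exp (- / y)).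
  + apply filter_imp with (fun y => 0 < y); [|now apply open_gt].
    intros y Hy; unfold exp_inv; destruct (Rlt_dec 0 y); [easy|lra].
  + unfold exp_inv; destruct (Rlt_dec 0 x); [|lra].
    auto_derive; [lra|].
    destruct n as [|n]; simpl; field; lra.
Qed.

(** Derivatives are constant-coefficient combinations of members of the same family, so the
    induction on the order treats all [n] at once. *)
Lemma ex_derive_n_exp_inv (k n : nat) (x : R) : ex_derive_n (exp_inv n) k x.
Proof.
enough (H : forall n x, diff_near k (exp_inv n) x)
  by (now apply (locally_singleton _ _ (H n x))).
clear n x; induction k as [|k IH]; intros n x; [apply diff_near_0|].
apply diff_near_S; split.
- exists (mkposreal 1 Rlt_0_1); intros y _. eexists; apply is_derive_exp_inv.
- apply diff_near_ext
    with (fun y => - INR n * exp_inv (S n) y + exp_inv (S (S n)) y).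
  + exists (mkposreal 1 Rlt_0_1); intros y _.
    symmetry; apply is_derive_unique, is_derive_exp_inv.
  + apply diff_near_plus; [|apply IH].
    apply diff_near_mult; [|apply IH].
    apply smooth_diff_near, smooth_const.
Qed.

(** Writing [- (x - d)] instead of [d - x] exhibits the second factor as a translate of a
    reflection, the form used to prove smoothness. *)
Definition bump (c d x : R) : R := exp_inv 0 (x - c) * exp_inv 0 (- (x - d)).

Lemma smooth_bump (c d : R) : smooth (bump c d).
Proof.
apply smooth_mult.
- intros n x.
  apply (ex_derive_n_comp_trans (exp_inv 0) n x (- c)), ex_derive_n_exp_inv.
- intros n x.
  apply (ex_derive_n_comp_trans (fun y => exp_inv 0 (- y)) n x (- d)).
  apply ex_derive_n_comp_opp.
  exists (mkposreal 1 Rlt_0_1); intros y _ k _; apply ex_derive_n_exp_inv.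
Qed.

Lemma bump_pos (c d x : R) : c < x < d -> 0 < bump c d x.
Proof.
intros Hx; unfold bump, exp_inv.
destruct (Rlt_dec 0 (x - c)); [|lra].
destruct (Rlt_dec 0 (- (x - d))); [|lra].
simpl; rewrite !Rmult_1_l. apply Rmult_lt_0_compat; apply exp_pos.
Qed.

Lemma bump_out (c d x : R) : ~ (c < x < d) -> bump c d x = 0.
Proof.
intros Hx; unfold bump, exp_inv.
destruct (Rlt_dec 0 (x - c)); [|ring].
destruct (Rlt_dec 0 (- (x - d))); [lra|ring].
Qed.

Lemma locally_bump_out (c d x : R) :
  ~ (c <= x <= d) -> locally x (fun y => bump c d y = 0).
Proof.
intros Hx. destruct (Rlt_dec x c) as [Hc|Hc].
- apply filter_imp with (fun y => y < c); [|now apply open_lt].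
  intros y Hy; apply bump_out; lra.
- apply filter_imp with (fun y => d < y); [|apply open_gt; lra].
  intros y Hy; apply bump_out; lra.
Qed.

(** * Integration by parts with one-sided derivatives *)

(** The retraction of the line onto [[c, d]]. Composition with it turns relative continuity on
    [[c, d]] into continuity everywhere. *)
Definition clamp (c d x : R) : R := Rmax c (Rmin x d).

Lemma clamp_itv (c d x : R) : c <= d -> itv c d (clamp c d x).
Proof.
intros Hcd; unfold itv, clamp, Rmax, Rmin.
destruct (Rle_dec x d); destruct (Rle_dec c _); lra.
Qed.

Lemma clamp_id (c d x : R) : itv c d x -> clamp c d x = x.
Proof.
unfold itv; intros Hx; unfold clamp; rewrite Rmin_left, Rmax_right; lra.
Qed.

Lemma clamp_lipschitz (c d x y : R) :
  Rabs (clamp c d y - clamp c d x) <= Rabs (y - x).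
Proof.
unfold clamp, Rmin; destruct (Rle_dec x d); destruct (Rle_dec y d);
  unfold Rmax; repeat destruct Rle_dec;
  unfold Rabs; repeat destruct Rcase_abs; lra.
Qed.

Lemma continuous_clamp (c d : R) (f : R -> R) :
  c <= d -> (forall x, itv c d x -> continue_in f (itv c d) x) ->
  forall x, continuous (fun y => f (clamp c d y)) x.
Proof.
intros Hcd Hf x. apply continuity_pt_filterlim. intros eps Heps.
destruct (Hf _ (clamp_itv c d x Hcd) eps Heps) as (alp & Halp & H).
exists alp; split; [exact Halp|]. intros y [_ Hy].
simpl in *; unfold Rdist in *.
(* [continue_in] says nothing about the centre point itself, and distinct points may be clamped to
   the same one. *)
destruct (Req_dec (clamp c d y) (clamp c d x)) as [E|E].
- rewrite E, Rminus_diag, Rabs_R0. exact Heps.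
- apply H; split; [split; [now apply clamp_itv|easy]|].
  eapply Rle_lt_trans; [apply clamp_lipschitz|exact Hy].
Qed.

Lemma ex_RInt_continue_in (c d : R) (f h : R -> R) :
  c <= d -> (forall x, itv c d x -> continue_in f (itv c d) x) ->
  (forall x, continuous h x) -> ex_RInt (fun x => f x * h x) c d.
Proof.
intros Hcd Hf Hh.
apply ex_RInt_ext with (fun x => f (clamp c d x) * h x).
- rewrite Rmin_left, Rmax_right by lra. intros x Hx.
  rewrite clamp_id; [easy|unfold itv; lra].
- apply @ex_RInt_continuous; intros x _.
  apply @continuous_mult; [now apply continuous_clamp|apply Hh].
Qed.

Lemma is_derive_D_in_interior (c d : R) (F f : R -> R) (x : R) :
  c < x < d -> D_in F f (itv c d) x -> is_derive F x (f x).
Proof.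
intros Hx HD. apply is_derive_Reals. intros eps Heps.
destruct (HD eps Heps) as (alp & Halp & H).
(* This radius keeps [x + t] inside [[c, d]], where [D_in] gives information. *)
assert (Hd : 0 < Rmin alp (Rmin (x - c) (d - x)))
  by (repeat apply Rmin_pos; lra).
exists (mkposreal _ Hd); intros t Ht Htd; simpl in *.
assert (H1 := Rmin_l alp (Rmin (x - c) (d - x))).
assert (H2 := Rmin_r alp (Rmin (x - c) (d - x))).
assert (H3 := Rmin_l (x - c) (d - x)).
assert (H4 := Rmin_r (x - c) (d - x)).
assert (H5 := Rabs_def2 _ _ Htd).
assert (H6 := H (x + t)). unfold Rdist in H6.
replace (x + t - x) with t in H6 by ring.
apply H6. unfold D_x, itv. repeat split; lra.
Qed.

(* [F o clamp - int_c f o clamp] has zero derivative inside [c, d] and is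
   continuous up to the end points, hence is constant on [c, d]. *)
Lemma is_RInt_D_in (c d : R) (F f : R -> R) :
  c < d -> (forall x, itv c d x -> D_in F f (itv c d) x) ->
  (forall x, itv c d x -> continue_in f (itv c d) x) ->
  is_RInt f c d (F d - F c).
Proof.
intros Hcd HF Hf.
assert (Cf := continuous_clamp c d f (Rlt_le _ _ Hcd) Hf).
assert (CF := continuous_clamp c d F (Rlt_le _ _ Hcd)
  (fun x Hx => cont_deriv _ _ _ _ (HF x Hx))).
set (fc := fun y => f (clamp c d y)) in *.
set (Fc := fun y => F (clamp c d y)) in *.
assert (Hex : forall u v, ex_RInt fc u v)
  by (intros; now apply @ex_RInt_continuous).
assert (HG : forall x, is_derive (fun y => RInt fc c y) x (fc x)).
{ intros x. apply @is_derive_RInt with c; [|apply Cf].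
  exists (mkposreal 1 Rlt_0_1); intros y _. now apply @RInt_correct. }
destruct (MVT_gen (fun y => Fc y - RInt fc c y) c d (fun _ => 0))
  as (z & _ & Hz).
- rewrite Rmin_left, Rmax_right by lra. intros x Hx.
  replace 0 with (fc x - fc x) by ring.
  apply @is_derive_minus; [|apply HG].
  apply is_derive_ext_loc with F.
  + apply filter_imp with (fun y => c < y < d).
    * intros y Hy; unfold Fc; rewrite clamp_id; [easy|unfold itv; lra].
    * apply filter_and; [now apply open_gt|now apply open_lt].
  + unfold fc; rewrite clamp_id by (unfold itv; lra).
    apply is_derive_D_in_interior with c d; [lra|apply HF; unfold itv; lra].
- intros x _. apply continuity_pt_filterlim.
  apply @continuous_minus; [apply CF|].
  apply @ex_derive_continuous. eexists; apply HG.
- rewrite RInt_point in Hz. unfold zero in Hz; simpl in Hz.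
  unfold Fc in Hz. rewrite !clamp_id in Hz by (unfold itv; lra).
  replace (F d - F c) with (RInt fc c d) by lra.
  apply is_RInt_ext with fc; [|now apply @RInt_correct].
  rewrite Rmin_left, Rmax_right by lra. intros x Hx.
  unfold fc; rewrite clamp_id; [easy|unfold itv; lra].
Qed.

Lemma is_derive_D_in (h dh : R -> R) (D : R -> Prop) (x : R) :
  is_derive h x (dh x) -> D_in h dh D x.
Proof.
intros H. apply is_derive_Reals in H. intros eps Heps.
destruct (H eps Heps) as (delta & Hd).
exists delta; split; [apply delta|]. intros y [[_ Hy] Hyx].
simpl in *; unfold Rdist in *.
specialize (Hd (y - x) ltac:(lra) Hyx).
now replace (x + (y - x)) with y in Hd by ring.
Qed.

Lemma continue_in_mult (D : R -> Prop) (f h : R -> R) (x : R) :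
  continue_in f D x -> continuous h x ->
  continue_in (fun y => f y * h y) D x.
Proof.
intros Hf Hh. apply limit_mul; [exact Hf|].
apply continuity_pt_filterlim in Hh. intros eps Heps.
destruct (Hh eps Heps) as (alp & Halp & H).
exists alp; split; [exact Halp|]. intros y [[_ Hy] Hyx].
apply H. repeat split; auto.
Qed.

(** The product rule integrates to the boundary values of [U * h], which vanish because [h] does at
    both ends; [U] only has derivatives relative to [[c, d]]. *)
Lemma RInt_by_parts (c d : R) (U dU h : R -> R) :
  c < d -> (forall x, itv c d x -> D_in U dU (itv c d) x) ->
  (forall x, itv c d x -> continue_in dU (itv c d) x) ->
  smooth h -> h c = 0 -> h d = 0 ->
  RInt (fun x => U x * Derive h x) c d = - RInt (fun x => dU x * h x) c d.
Proof.
intros Hcd HU HdU Hh Hc Hd.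
assert (Ch := fun x => smooth_continuous h x Hh).
assert (CDh := fun x => smooth_continuous _ x (smooth_Derive h Hh)).
assert (CU := fun x Hx => cont_deriv _ _ _ _ (HU x Hx)).
assert (H : is_RInt (fun x => dU x * h x + U x * Derive h x) c d
  (U d * h d - U c * h c)).
{ apply (is_RInt_D_in c d (fun x => U x * h x)); [exact Hcd|..]; intros x Hx.
  - apply Dmult; [now apply HU|]. now apply is_derive_D_in, smooth_is_derive.
  - apply limit_plus; apply continue_in_mult; auto. }
apply (is_RInt_unique (V := R_CompleteNormedModule)) in H.
rewrite Hc, Hd, !Rmult_0_r, Rminus_diag in H.
rewrite (RInt_plus (V := R_CompleteNormedModule)) in H;
  [|apply ex_RInt_continue_in; auto; lra..].
unfold plus in H; simpl in H. lra.
Qed.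

(** * Repeated integration by parts and the weak form of the equation *)

Lemma derivatives_on_continue_in (c d : R) (k : nat) (u : R -> R)
  (U : nat -> R -> R) (j : nat) (x : R) :
  derivatives_on c d k u U -> (j <= k)%nat -> itv c d x ->
  continue_in (U j) (itv c d) x.
Proof.
intros (_ & HD & HC) Hj Hx.
destruct (Nat.eq_dec j k) as [->|Hjk]; [now apply HC|].
apply cont_deriv with (U (S j)). apply HD; auto; lia.
Qed.

Lemma RInt_Derive_n_by_parts (c d : R) (N : nat) (u : R -> R)
  (U : nat -> R -> R) (j : nat) (h : R -> R) :
  c < d -> derivatives_on c d N u U -> (j <= N)%nat -> smooth h ->
  (forall k, (k < j)%nat -> Derive_n h k c = 0 /\ Derive_n h k d = 0) ->
  RInt (fun x => u x * Derive_n h j x) c d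
    = (-1) ^ j * RInt (fun x => U j x * h x) c d.
Proof.
intros Hcd HU Hj Hh H0.
(* The relative derivatives are attached to [U 0], which equals [u] on the interval. *)
rewrite (RInt_ext _ (fun x => U 0%nat x * Derive_n h j x)).
2:{ rewrite Rmin_left, Rmax_right by lra. intros x Hx.
  rewrite (proj1 HU); [easy|unfold itv; lra]. }
revert h Hh H0; induction j as [|j IH]; intros h Hh H0.
- simpl. now rewrite Rmult_1_l.
- rewrite (RInt_ext _ (fun x => U 0%nat x * Derive_n (Derive h) j x))
    by (intros; now rewrite Derive_n_Derive).
  (* The induction hypothesis for [Derive h] moves [j] derivatives to [U]; one more integration by
     parts moves the last. *)
  rewrite IH; [|lia|now apply smooth_Derive|].
  + rewrite (RInt_by_parts c d (U j) (U (S j))); auto.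
    * simpl. ring.
    * apply (proj1 (proj2 HU)); lia.
    * intros x Hx. now apply derivatives_on_continue_in with N u.
    * apply (H0 0%nat); lia.
    * apply (H0 0%nat); lia.
  + intros k Hk. rewrite !Derive_n_Derive. apply H0; lia.
Qed.

Lemma is_RInt_sum_n (c d : R) (f : nat -> R -> R) (n : nat) :
  (forall j, (j <= n)%nat -> ex_RInt (f j) c d) ->
  is_RInt (fun x => sum_n (fun j => f j x) n) c d
    (sum_n (fun j => RInt (f j) c d) n).
Proof.
induction n as [|n IH]; intros H.
- rewrite sum_O. apply is_RInt_ext with (f 0%nat).
  + intros; now rewrite sum_O.
  + apply @RInt_correct, H; lia.
- rewrite sum_Sn.
  apply is_RInt_ext with (fun x => plus (sum_n (fun j => f j x) n) (f (S n) x)).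
  + intros; now rewrite sum_Sn.
  + apply @is_RInt_plus; [apply IH; intros; apply H; lia|].
    apply @RInt_correct, H; lia.
Qed.

(** The formal adjoint of the operator, applied to [w], is orthogonal to [u]: integration by parts
    turns the sum into the integral of the vanishing left-hand side of the equation times [w], the
    two signs [(-1) ^ j] cancelling. *)
Lemma is_solution_on_weak (c d : R) (N : nat) (p : nat -> R -> R)
  (u w : R -> R) :
  c < d -> is_solution_on c d N p u ->
  (forall j, (j <= N)%nat -> smooth (p j)) -> smooth w ->
  (forall k, (k < N)%nat -> Derive_n w k c = 0 /\ Derive_n w k d = 0) ->
  sum_n (fun j => (-1) ^ j *
    RInt (fun x => u x * Derive_n (fun y => p j y * w y) j x) c d) N = 0.
Proof.
intros Hcd (U & HU & Hsol) Hp Hw H0.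
assert (Hex : forall j, (j <= N)%nat ->
  ex_RInt (fun x => U j x * (p j x * w x)) c d).
{ intros j Hj; apply ex_RInt_continue_in; [lra|..].
  - intros x Hx. now apply derivatives_on_continue_in with N u.
  - intros x. apply smooth_continuous, smooth_mult; auto. }
rewrite (sum_n_ext_loc _
  (fun j => RInt (fun x => U j x * (p j x * w x)) c d)).
- rewrite <- (is_RInt_unique _ _ _ _
    (is_RInt_sum_n c d (fun j x => U j x * (p j x * w x)) N Hex)).
  rewrite (RInt_ext _ (fun _ => 0)).
  + rewrite RInt_const. apply Rmult_0_r.
  + rewrite Rmin_left, Rmax_right by lra. intros x Hx.
    rewrite (sum_n_ext _ (fun j => mult (p j x * U j x) (w x)))
      by (intros j; unfold mult; simpl; ring).
    rewrite sum_n_mult_r, Hsol by (unfold itv; lra). apply Rmult_0_l.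
- intros j Hj. rewrite (RInt_Derive_n_by_parts c d N u U); auto.
  + rewrite <- Rmult_assoc, <- Rpow_mult_distr.
    replace (-1 * -1) with 1 by ring. now rewrite pow1, Rmult_1_l.
  + apply smooth_mult; auto.
  + intros k Hk; split; apply Derive_n_mult_zero_jet;
      try (apply smooth_diff_near; auto);
      intros i Hi; apply H0; lia.
Qed.

(** * Test functions *)

Lemma iter_dist_derive (a b : R) (r h : R -> R) (j : nat) :
  Nat.iter j dist_derive (dist_of_fun a b r) h
    = (-1) ^ j * RInt (fun x => r x * Derive_n h j x) a b.
Proof.
revert h; induction j as [|j IH]; intros h.
- simpl. now rewrite Rmult_1_l.
- change (- Nat.iter j dist_derive (dist_of_fun a b r) (Derive h)
    = (-1) ^ S j * RInt (fun x => r x * Derive_n h (S j) x) a b).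
  rewrite IH, (RInt_ext _ (fun x => r x * Derive_n h (S j) x)).
  + simpl. ring.
  + intros; now rewrite Derive_n_Derive.
Qed.

Lemma hat_opE (a b : R) (K N : nat) (xi : nat -> R) (p : nat -> R -> R)
  (r phi : R -> R) :
  hat_op K N xi p (dist_of_fun a b r) phi
  = sum_n (fun j => (-1) ^ j * RInt (fun x => r x *
      Derive_n (fun y => p j y * (jump_factor K N xi y * phi y)) j x) a b) N.
Proof.
apply sum_n_ext; intros j. apply iter_dist_derive.
Qed.

(** * Vanishing of the jump factor and annihilation on test functions *)

Lemma smooth_jump_product (N : nat) (xi : nat -> R) (l : list nat) :
  smooth (fun x => fold_right Rmult 1 (map (fun i => (x - xi i) ^ N) l)).
Proof.
induction l as [|i l IH]; simpl; [apply smooth_const|].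
apply smooth_mult; [apply smooth_pow_trans|exact IH].
Qed.

Lemma jump_product_split (N : nat) (xi : nat -> R) (l : list nat) (i : nat) :
  In i l -> exists h, smooth h /\ forall x,
    fold_right Rmult 1 (map (fun i => (x - xi i) ^ N) l) = (x - xi i) ^ N * h x.
Proof.
induction l as [|j l IH]; [easy|]. intros [->|Hi]; simpl.
- eexists; split; [apply (smooth_jump_product N xi l)|easy].
- destruct (IH Hi) as (h & Hh & E).
  exists (fun x => (x - xi j) ^ N * h x); split.
  + apply smooth_mult; [apply smooth_pow_trans|exact Hh].
  + intros x; rewrite E; ring.
Qed.

(** At a jump point the factor [(x - xi n) ^ N] provides the zero; at [a] and [b], which contribute
    no factor, the support of [phi] does. *)
Lemma Derive_n_jump_factor (a b : R) (K N : nat) (xi : nat -> R)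
  (phi : R -> R) (n k : nat) :
  is_partition a b K xi -> is_test a b phi -> (n <= S K)%nat -> (k < N)%nat ->
  Derive_n (fun x => jump_factor K N xi x * phi x) k (xi n) = 0.
Proof.
intros (Ha & Hb & Hxi) (Hphi & c & d & Hc & Hd & Hsupp) Hn Hk.
destruct (Nat.eq_dec n 0) as [->|Hn0];
  [|destruct (Nat.eq_dec n (S K)) as [->|HnK]].
- apply Derive_n_locally_zero, filter_imp with (fun y => y < c).
  + intros y Hy. destruct (Req_dec (phi y) 0) as [E|E]; [rewrite E; ring|].
    apply Hsupp in E; lra.
  + apply open_lt; lra.
- apply Derive_n_locally_zero, filter_imp with (fun y => d < y).
  + intros y Hy. destruct (Req_dec (phi y) 0) as [E|E]; [rewrite E; ring|].
    apply Hsupp in E; lra.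
  + apply open_gt; lra.
- destruct (jump_product_split N xi (seq 1 K) n) as (h & Hh & E);
    [apply in_seq; lia|].
  rewrite (Derive_n_ext _ (fun x => (x - xi n) ^ N * (h x * phi x))).
  + apply Derive_n_pow_mult_lt; [|exact Hk]. now apply smooth_mult.
  + intros x; unfold jump_factor; rewrite E; ring.
Qed.

Lemma hat_op_test (a b : R) (K N : nat) (xi : nat -> R)
  (p : nat -> R -> R) (g : nat -> R -> R) (phi : R -> R) :
  is_partition a b K xi ->
  (forall j, (j <= N)%nat -> is_polynomial (p j)) ->
  (forall n, (n <= K)%nat -> is_solution_on (xi n) (xi (S n)) N p (g n)) ->
  is_test a b phi ->
  hat_op K N xi p (dist_of_fun a b (glue K xi g)) phi = 0.
Proof.
intros Hxi Hp Hg Hphi. rewrite hat_opE.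
set (w := fun y => jump_factor K N xi y * phi y).
assert (Hw : smooth w)
  by (apply smooth_mult; [apply smooth_jump_product|exact (proj1 Hphi)]).
assert (Hps : forall j, (j <= N)%nat -> smooth (p j))
  by (intros; now apply smooth_polynomial, Hp).
assert (Hpw : forall j, (j <= N)%nat -> smooth (fun y => p j y * w y))
  by (intros; apply smooth_mult; auto).
(* Open pieces suffice for integrals; at an interior node [glue] takes the value of the piece on its
   right. *)
assert (Hpiece : forall n j x, (n <= K)%nat -> xi n < x < xi (S n) ->
  g n x * Derive_n (fun y => p j y * w y) j x
  = glue K xi g x * Derive_n (fun y => p j y * w y) j x).
{ intros n j x Hn Hx. rewrite (glueE a b K xi g n); auto; lra. }
(* Pieces are added from left to right; integrability is carried along because [RInt_Chasles] asks
   for it. *)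
assert (H : forall m, (m <= S K)%nat ->
  (forall j, (j <= N)%nat -> ex_RInt (fun x => glue K xi g x
     * Derive_n (fun y => p j y * w y) j x) (xi 0%nat) (xi m)) /\
  sum_n (fun j => (-1) ^ j * RInt (fun x => glue K xi g x
     * Derive_n (fun y => p j y * w y) j x) (xi 0%nat) (xi m)) N = 0).
{ induction m as [|m IH]; intros Hm.
  - split; [intros; apply @ex_RInt_point|].
    rewrite (sum_n_ext _ (fun _ => 0)).
    + rewrite sum_n_const. apply Rmult_0_r.
    + intros j; rewrite RInt_point. apply Rmult_0_r.
  - destruct (IH ltac:(lia)) as [IH1 IH2].
    assert (Hlt := proj2 (proj2 Hxi) m ltac:(lia)).
    assert (HgU := Hg m ltac:(lia)).
    assert (Hex : forall j, (j <= N)%nat -> ex_RInt (fun x => glue K xi g x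
      * Derive_n (fun y => p j y * w y) j x) (xi m) (xi (S m))).
    { intros j Hj. destruct HgU as (U & HU & _).
      apply ex_RInt_ext with
        (fun x => U 0%nat x * Derive_n (fun y => p j y * w y) j x).
      - rewrite Rmin_left, Rmax_right by lra. intros x Hx.
        rewrite (proj1 HU) by (unfold itv; lra). apply Hpiece; [lia|lra].
      - apply ex_RInt_continue_in; [lra|..].
        + intros x Hx.
          apply derivatives_on_continue_in with N (g m); auto; lia.
        + intros x; apply smooth_continuous, smooth_Derive_n; auto. }
    split; [intros j Hj; apply @ex_RInt_Chasles with (xi m); auto|].
    rewrite (sum_n_ext_loc _ (fun j => plus
      ((-1) ^ j * RInt (fun x => glue K xi g x
         * Derive_n (fun y => p j y * w y) j x) (xi 0%nat) (xi m))
      ((-1) ^ j * RInt (fun x => g m x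
         * Derive_n (fun y => p j y * w y) j x) (xi m) (xi (S m))))).
    + rewrite sum_n_plus, IH2, is_solution_on_weak; auto.
      * unfold plus; simpl; ring.
      * intros k Hk; split; apply Derive_n_jump_factor with a b; auto; lia.
    + intros j Hj. unfold plus; simpl.
      rewrite <- (RInt_Chasles _ (xi 0%nat) (xi m) (xi (S m))); auto.
      rewrite (RInt_ext (fun x => g m x * _) (fun x => glue K xi g x
        * Derive_n (fun y => p j y * w y) j x) (xi m)).
      * unfold plus; simpl; ring.
      * rewrite Rmin_left, Rmax_right by lra. intros x Hx.
        apply Hpiece; [lia|lra]. }
destruct Hxi as (Ha & Hb & _). rewrite <- Ha, <- Hb.
now apply H.
Qed.

(** * Extension to functions of class C^(N-1) *)

Lemma is_test_plus (a b : R) (f h : R -> R) :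
  is_test a b f -> is_test a b h -> is_test a b (fun x => f x + h x).
Proof.
intros (Hf & c & d & Hc & Hd & Hs) (Hh & c' & d' & Hc' & Hd' & Hs').
split; [now apply smooth_plus|].
exists (Rmin c c'), (Rmax d d').
split; [now apply Rmin_glb_lt|]. split; [now apply Rmax_lub_lt|].
intros x Hx.
assert (H1 := Rmin_l c c'); assert (H2 := Rmin_r c c').
assert (H3 := Rmax_l d d'); assert (H4 := Rmax_r d d').
destruct (Req_dec (f x) 0) as [E|E]; [|apply Hs in E; lra].
destruct (Req_dec (h x) 0) as [E'|E']; [lra|apply Hs' in E'; lra].
Qed.

Lemma is_test_supported (a b c d : R) (f : R -> R) :
  a < c -> d < b -> smooth f -> (forall x, ~ (c < x < d) -> f x = 0) ->
  is_test a b f.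
Proof.
intros Hc Hd Hf H; split; [exact Hf|]. exists c, d; repeat split; auto.
- destruct (Rle_dec c x) as [E|E]; [exact E|]. elim H0; apply H; lra.
- destruct (Rle_dec x d) as [E|E]; [exact E|]. elim H0; apply H; lra.
Qed.

(** Used to keep the supports of bump functions off the jump points; [x] may itself be one of
    them. *)
Lemma isolated (l : list R) (x : R) :
  exists delta, 0 < delta /\
    forall y, In y l -> y <> x -> delta < Rabs (y - x).
Proof.
induction l as [|z l (delta & Hd & H)].
- exists 1; split; [lra|easy].
- destruct (Req_dec z x) as [E|E].
  + exists delta; split; [exact Hd|]. intros y [->|Hy] Hyx; [easy|auto].
  + assert (Hz := Rabs_pos_lt (z - x) ltac:(lra)).
    (* Halving makes the inequality strict for the new entry [z]. *)
    exists (Rmin delta (Rabs (z - x) / 2)); split; [apply Rmin_pos; lra|].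
    assert (H1 := Rmin_l delta (Rabs (z - x) / 2)).
    assert (H2 := Rmin_r delta (Rabs (z - x) / 2)).
    intros y [<-|Hy] Hyx; [lra|]. specialize (H y Hy Hyx); lra.
Qed.

(** A triangular system: a multiple of [(y - x) ^ n] times a bump adjusts the derivative of order
    [n] at [x] and leaves the lower ones unchanged. *)
Lemma exists_jet (x delta : R) (v : nat -> R) (n : nat) :
  0 < delta ->
  exists phi, smooth phi /\
    (forall k, (k < n)%nat -> Derive_n phi k x = v k) /\
    forall y, ~ (x - delta < y < x + delta) -> phi y = 0.
Proof.
intros Hdelta; induction n as [|n (phi & Hphi & Hv & Hs)].
- exists (fun _ => 0); split; [apply smooth_const|split; [lia|easy]].
- set (h := fun y => (y - x) ^ n * bump (x - delta) (x + delta) y).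
  assert (Hb := smooth_bump (x - delta) (x + delta)).
  assert (Hh : smooth h)
    by (apply smooth_mult; [apply smooth_pow_trans|exact Hb]).
  assert (Hn : Derive_n h n x <> 0).
  { apply Derive_n_pow_mult_neq; [exact Hb|].
    apply Rgt_not_eq, bump_pos; lra. }
  set (z := (v n - Derive_n phi n x) / Derive_n h n x).
  assert (Hzh : smooth (fun y => z * h y))
    by (apply smooth_mult; [apply smooth_const|exact Hh]).
  exists (fun y => phi y + z * h y); split; [now apply smooth_plus|split].
  + intros k Hk. rewrite Derive_n_plus; [|now apply smooth_diff_near..].
    rewrite Derive_n_scal_l.
    destruct (Nat.eq_dec k n) as [->|Hkn].
    * unfold z; field; exact Hn.
    * unfold h; rewrite Hv, Derive_n_pow_mult_lt by (exact Hb || lia). ring.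
  + intros y Hy. unfold h; rewrite Hs, bump_out by exact Hy. ring.
Qed.

(** Hermite interpolation by a test function. Nodes are treated from left to right, each correction
    being supported too close to its node to disturb the earlier ones. *)
Lemma exists_jets (a b : R) (K : nat) (xi : nat -> R) (v : nat -> nat -> R)
  (n : nat) :
  is_partition a b K xi ->
  exists phi, is_test a b phi /\
    forall i k, (1 <= i <= K)%nat -> (k < n)%nat ->
      Derive_n phi k (xi i) = v i k.
Proof.
intros Hxi.
assert (H : forall m, (m <= K)%nat -> exists phi, is_test a b phi /\
  forall i k, (1 <= i <= m)%nat -> (k < n)%nat ->
    Derive_n phi k (xi i) = v i k).
{ induction m as [|m IH]; intros Hm.
  - assert (H1 := proj2 (proj2 Hxi) 0%nat ltac:(lia)).
    assert (H2 := is_partition_le a b K xi 1 (S K) Hxi ltac:(lia)).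
    destruct Hxi as (Ha & Hb & _). rewrite Ha in H1; rewrite Hb in H2.
    exists (fun _ => 0); split; [|lia].
    (* The zero function vanishes off the empty open interval at the midpoint. *)
    apply is_test_supported with ((a + b) / 2) ((a + b) / 2);
      [lra|lra|apply smooth_const|easy].
  - destruct (IH ltac:(lia)) as (phi & Hphi & Hv).
    assert (H1 := proj2 (proj2 Hxi) m ltac:(lia)).
    assert (H2 := proj2 (proj2 Hxi) (S m) ltac:(lia)).
    assert (H3 := is_partition_le a b K xi 0 m Hxi ltac:(lia)).
    assert (H4 := is_partition_le a b K xi (S (S m)) (S K) Hxi ltac:(lia)).
    assert (Hab : xi 0%nat = a /\ xi (S K) = b)
      by (split; [apply Hxi|apply (proj1 (proj2 Hxi))]).
    destruct Hab as [Ha Hb]; rewrite Ha in H3; rewrite Hb in H4.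
    (* Half the distance to the nearer neighbouring node, so that the support also stays inside
       [(a, b)]. *)
    set (delta := Rmin (xi (S m) - xi m) (xi (S (S m)) - xi (S m)) / 2).
    assert (H5 := Rmin_l (xi (S m) - xi m) (xi (S (S m)) - xi (S m))).
    assert (H6 := Rmin_r (xi (S m) - xi m) (xi (S (S m)) - xi (S m))).
    assert (H7 : 0 < Rmin (xi (S m) - xi m) (xi (S (S m)) - xi (S m)))
      by (apply Rmin_pos; lra).
    (* The prescribed values are corrected by what [phi] already contributes at the new node. *)
    destruct (exists_jet (xi (S m)) delta
      (fun k => v (S m) k - Derive_n phi k (xi (S m))) n)
      as (psi & Hpsi & Hjet & Hs); [unfold delta; lra|].
    exists (fun x => phi x + psi x); split.
    + apply is_test_plus; [exact Hphi|].
      apply is_test_supported with (xi (S m) - delta) (xi (S m) + delta);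
        auto; unfold delta; lra.
    + intros i k Hi Hk.
      rewrite Derive_n_plus;
        [|exact (smooth_diff_near _ _ _ (proj1 Hphi))|now apply smooth_diff_near].
      destruct (Nat.eq_dec i (S m)) as [->|Him]; [rewrite Hjet by exact Hk; ring|].
      rewrite Hv, (Derive_n_locally_zero psi); [ring| |lia|exact Hk].
      assert (H8 := is_partition_le a b K xi i m Hxi ltac:(lia)).
      apply filter_imp with (fun y => y < xi (S m) - delta).
      * intros y Hy; apply Hs; lra.
      * apply open_lt; unfold delta; lra. }
now apply H.
Qed.

(** At each jump point [f - h] has zero derivatives up to order [N - 1], the largest order of a
    delta term, so its product with the coefficient does too. *)
Lemma delta_terms_pair_jet (K N : nat) (xi : nat -> R) (l : list delta_term)
  (f h : R -> R) :
  List.Forall (delta_term_ok K N xi) l ->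
  (forall i, (1 <= i <= K)%nat -> diff_near (N - 1) f (xi i)) ->
  (forall i, (1 <= i <= K)%nat -> diff_near (N - 1) h (xi i)) ->
  (forall i k, (1 <= i <= K)%nat -> (k <= N - 1)%nat ->
     Derive_n f k (xi i) = Derive_n h k (xi i)) ->
  fold_right Rplus 0 (map (delta_term_pair xi f) l)
    = fold_right Rplus 0 (map (delta_term_pair xi h) l).
Proof.
intros Hl Hf Hh Hfh. f_equal. apply map_ext_in. intros t Ht.
rewrite List.Forall_forall in Hl.
destruct (Hl t Ht) as (Hord & Hidx & Hcoef).
change (diff_near (dt_order t) (dt_coef t) (xi (dt_index t))) in Hcoef.
assert (Hf' := diff_near_le _ _ _ _ Hord (Hf _ Hidx)).
assert (Hh' := diff_near_le _ _ _ _ Hord (Hh _ Hidx)).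
unfold delta_term_pair; f_equal.
apply Rminus_diag_uniq.
rewrite <- Derive_n_minus by now apply diff_near_mult.
rewrite (Derive_n_ext _ (fun y => dt_coef t y * (f y - h y)))
  by (intros; ring).
apply Derive_n_mult_zero_jet; [exact Hcoef|now apply diff_near_minus|].
intros k Hk. rewrite Derive_n_minus; [rewrite Hfh by (auto; lia); ring|..].
- now apply diff_near_le with (dt_order t).
- now apply diff_near_le with (dt_order t).
Qed.

Lemma delta_terms_pair_locally_zero (K N : nat) (xi : nat -> R)
  (l : list delta_term) (f : R -> R) :
  List.Forall (delta_term_ok K N xi) l ->
  (forall i, (1 <= i <= K)%nat -> locally (xi i) (fun y => f y = 0)) ->
  fold_right Rplus 0 (map (delta_term_pair xi f) l) = 0.
Proof.
intros Hl Hf; induction Hl as [|t l (_ & Hidx & _) Hl IH]; [easy|].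
simpl. rewrite IH. unfold delta_term_pair.
rewrite Derive_n_locally_zero; [ring|].
generalize (Hf _ Hidx); apply filter_imp; intros y ->; ring.
Qed.

(** * Vanishing of the function part of an expression *)

Lemma is_RInt_zero (a b : R) (f : R -> R) :
  (forall x, Rmin a b < x < Rmax a b -> f x = 0) -> is_RInt f a b 0.
Proof.
intros H. apply is_RInt_ext with (fun _ => 0); [intros; now rewrite H|].
assert (H1 := is_RInt_const (V := R_NormedModule) a b 0).
change (is_RInt (fun _ => 0) a b ((b - a) * 0)) in H1.
now rewrite Rmult_0_r in H1.
Qed.

(** The fundamental lemma of the calculus of variations: near a point where the function part is
    non-zero, a bump avoiding the jump points sees no delta term and would have a non-zero
    pairing. *)
Lemma delta_sum_fun_zero (a b : R) (K N : nat) (xi : nat -> R)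
  (s : delta_sum) (m : nat) (t : nat -> R) (i : nat) (h : R -> R) :
  delta_sum_ok a b K N xi s ->
  (forall phi, is_test a b phi -> delta_sum_pair a b xi s phi = 0) ->
  is_partition a b m t -> (i <= m)%nat -> Cn_on (t i) (t (S i)) 0 h ->
  (forall x, t i < x < t (S i) -> ds_fun s x = h x) ->
  forall x, t i < x < t (S i) -> ds_fun s x = 0.
Proof.
intros [_ Hterms] Hpair Ht Hi (U & HU & _ & HC) Hrh x Hx.
assert (Hlt := proj2 (proj2 Ht) i Hi).
set (q := fun y => U 0%nat (clamp (t i) (t (S i)) y)).
assert (Cq : forall y, continuous q y)
  by (apply continuous_clamp; [lra|exact HC]).
assert (Hrq : forall y, t i < y < t (S i) -> ds_fun s y = q y).
{ intros y Hy. assert (Hy' : itv (t i) (t (S i)) y) by (unfold itv; lra).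
  unfold q. rewrite clamp_id, HU by exact Hy'. now apply Hrh. }
rewrite Hrq by exact Hx.
destruct (Req_dec (q x) 0) as [E|E]; [exact E|exfalso].
(* The product with [q x] treats both signs at once. *)
assert (Hloc : locally x (fun y => 0 < q x * q y)).
{ apply (continuous_mult (fun _ => q x) q x (continuous_const _ _) (Cq x)
    (fun z => 0 < z)).
  apply open_gt. change (0 < q x * q x). nra. }
destruct Hloc as (d1 & Hd1).
destruct (isolated (map xi (seq 1 K)) x) as (d2 & Hd2 & Hiso).
(* The three bounds preserve the sign of [q], avoid the jump points other than [x], and stay in the
   piece. *)
set (e := Rmin d1 (Rmin d2 (t (S i) - x))).
assert (He : 0 < e)
  by (repeat apply Rmin_pos; [apply cond_pos|exact Hd2|lra]).
assert (He1 : e <= d1) by apply Rmin_l.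
assert (He2 : e <= d2) by (eapply Rle_trans; [apply Rmin_r|apply Rmin_l]).
assert (He3 : e <= t (S i) - x)
  by (eapply Rle_trans; [apply Rmin_r|apply Rmin_r]).
(* The bump lies strictly to the right of [x], because [x] may be a jump point. *)
set (c := x + e / 3). set (d := x + 2 * (e / 3)).
assert (H1 := is_partition_le a b m t 0 i Ht ltac:(lia)).
assert (H2 := is_partition_le a b m t (S i) (S m) Ht ltac:(lia)).
rewrite (proj1 Ht) in H1. rewrite (proj1 (proj2 Ht)) in H2.
assert (Hac : a < c) by (unfold c; lra).
assert (Hcd : c < d) by (unfold c, d; lra).
assert (Hdb : d < b) by (unfold d; lra).
assert (Hpiece : forall y, c <= y <= d -> t i < y < t (S i))
  by (unfold c, d; intros; lra).
set (F := fun y => ds_fun s y * bump c d y).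
assert (CF : forall y, c <= y <= d -> continuous F y).
{ intros y Hy. apply @continuous_mult; [|apply smooth_continuous, smooth_bump].
  apply continuous_ext_loc with q; [|apply Cq].
  apply filter_imp with (fun y => t i < y < t (S i)).
  - intros z Hz; symmetry; now apply Hrq.
  - apply filter_and; [apply open_gt|apply open_lt]; apply Hpiece; lra. }
assert (HexF : ex_RInt F c d).
{ apply @ex_RInt_continuous. rewrite Rmin_left, Rmax_right by lra.
  exact CF. }
assert (Hpos : 0 < q x * RInt F c d).
{ change (0 < scal (q x) (RInt F c d)).
  rewrite <- (RInt_scal (V := R_CompleteNormedModule)) by exact HexF.
  apply RInt_gt_0; [exact Hcd|..]; intros y Hy.
  - unfold scal; simpl; unfold mult; simpl; unfold F.
    rewrite Hrq by (apply Hpiece; lra).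
    rewrite <- Rmult_assoc. apply Rmult_lt_0_compat; [|now apply bump_pos].
    apply Hd1. unfold ball; simpl.
    unfold AbsRing_ball, abs, minus, plus, opp; simpl.
    apply Rabs_def1; unfold c, d in Hy; lra.
  - apply @continuous_mult; [apply continuous_const|now apply CF]. }
assert (Hab : is_RInt F a b (0 + (RInt F c d + 0))).
{ apply (is_RInt_Chasles F a c b 0 (RInt F c d + 0)).
  - apply is_RInt_zero. rewrite Rmin_left, Rmax_right by lra.
    intros y Hy; unfold F; rewrite bump_out by lra; ring.
  - apply (is_RInt_Chasles F c d b (RInt F c d) 0).
    + now apply @RInt_correct.
    + apply is_RInt_zero. rewrite Rmin_left, Rmax_right by lra.
      intros y Hy; unfold F; rewrite bump_out by lra; ring. }
assert (Hzero := Hpair (bump c d)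
  (is_test_supported a b c d _ Hac Hdb (smooth_bump c d) (bump_out c d))).
unfold delta_sum_pair in Hzero.
rewrite (delta_terms_pair_locally_zero K N) in Hzero; [|exact Hterms|].
- apply (is_RInt_unique (V := R_CompleteNormedModule)) in Hab. fold F in Hzero.
  rewrite Hab in Hzero. replace (RInt F c d) with 0 in Hpos by lra. lra.
- intros j Hj. apply locally_bump_out.
  destruct (Req_dec (xi j) x) as [Ej|Ej]; [rewrite Ej; unfold c; lra|].
  assert (Hj' := Hiso (xi j) ltac:(apply in_map, in_seq; lia) Ej).
  intros Hcj; unfold c, d in Hcj. rewrite Rabs_pos_eq in Hj'; lra.
Qed.

(** The integrand is zero inside every piece whatever the factor [f], and the finitely many break
    points do not affect the integral. *)
Lemma delta_sum_RInt_zero (a b : R) (K N : nat) (xi : nat -> R)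
  (s : delta_sum) (f : R -> R) :
  delta_sum_ok a b K N xi s ->
  (forall phi, is_test a b phi -> delta_sum_pair a b xi s phi = 0) ->
  RInt (fun x => ds_fun s x * f x) a b = 0.
Proof.
intros Hs Hpair. assert (Hpc := proj1 Hs).
destruct Hpc as (m & t & Ht & Hr).
assert (H : forall k, (k <= S m)%nat ->
  is_RInt (fun x => ds_fun s x * f x) (t 0%nat) (t k) 0).
{ induction k as [|k IH]; intros Hk.
  - apply is_RInt_zero. rewrite Rmin_left, Rmax_left by lra. intros; lra.
  - assert (Hlt := proj2 (proj2 Ht) k ltac:(lia)).
    rewrite <- (Rplus_0_l 0).
    apply (is_RInt_Chasles _ _ (t k) _ 0 0); [apply IH; lia|].
    apply is_RInt_zero. rewrite Rmin_left, Rmax_right by lra.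
    intros x Hx. destruct (Hr k ltac:(lia)) as (h & Hh & Hrh).
    rewrite (delta_sum_fun_zero a b K N xi s m t k h) by (auto; lia).
    ring. }
rewrite <- (proj1 Ht), <- (proj1 (proj2 Ht)).
apply is_RInt_unique, H; lia.
Qed.

(** Inside the interval relative derivatives are ordinary ones. The induction covers the whole open
    interval, so that the identity can be differentiated. *)
Lemma derivatives_on_Derive_n (c d : R) (k : nat) (u : R -> R)
  (U : nat -> R -> R) (j : nat) (x : R) :
  derivatives_on c d k u U -> (j <= k)%nat -> c < x < d ->
  Derive_n u j x = U j x /\ ex_derive_n u j x.
Proof.
intros (HU0 & HD & _). revert x; induction j as [|j IH]; intros x Hj Hx.
- split; [symmetry; apply HU0; unfold itv; lra|exact I].
- assert (Hd : is_derive (Derive_n u j) x (U (S j) x)).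
  { apply is_derive_ext_loc with (U j).
    - apply filter_imp with (fun y => c < y < d).
      + intros y Hy; symmetry; apply IH; [lia|exact Hy].
      + apply filter_and; [apply open_gt|apply open_lt]; lra.
    - apply is_derive_D_in_interior with c d; [exact Hx|].
      apply HD; [lia|unfold itv; lra]. }
  split; [now apply is_derive_unique|]. eexists; exact Hd.
Qed.

Lemma Cn_on_diff_near (c d : R) (k : nat) (u : R -> R) (x : R) :
  Cn_on c d k u -> c < x < d -> diff_near k u x.
Proof.
intros (U & HU) Hx; unfold diff_near.
apply filter_imp with (fun y => c < y < d).
- intros y Hy j Hj. now apply (derivatives_on_Derive_n c d k u U).
- apply filter_and; [apply open_gt|apply open_lt]; lra.
Qed.

Theorem theorem2p12 (a b : R) (K N : nat) (xi : nat -> R)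
  (p : nat -> R -> R) (g : nat -> R -> R)
  (HN : (1 <= N)%nat)
  (Hxi : is_partition a b K xi)
  (Hp : forall j, (j <= N)%nat -> is_polynomial (p j))
  (HpN : forall x, a <= x <= b -> p N x <> 0)
  (Hg : forall n, (n <= K)%nat ->
          is_solution_on (xi n) (xi (S n)) N p (g n)) :
  forall f : R -> R, Cn_on a b (N - 1) f ->
    dist_pairing a b K N xi
      (hat_op K N xi p (dist_of_fun a b (glue K xi g))) f 0.
Proof.
intros f Hf.
assert (H0 := fun phi => hat_op_test a b K N xi p g phi Hxi Hp Hg).
split.
(* The distribution vanishes on test functions, so the empty expression represents it. *)
- exists (DeltaSum (fun _ => 0) nil); split; [split|].
  + exists K, xi; split; [exact Hxi|]. intros i _.
    exists (fun _ => 0); split; [|easy].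
    exists (fun _ _ => 0); repeat split; [lia|].
    intros x _ eps Heps; exists 1; split; [lra|]. intros y _.
    simpl. unfold Rdist. now rewrite Rminus_diag, Rabs_R0.
  + constructor.
  + intros phi Hphi. rewrite H0 by exact Hphi. unfold delta_sum_pair; simpl.
    rewrite (is_RInt_unique _ _ _ 0); [ring|].
    apply is_RInt_zero; intros; ring.
- intros s [Hs Hrep].
  assert (Hpair : forall phi, is_test a b phi ->
    delta_sum_pair a b xi s phi = 0)
    by (intros phi Hphi; rewrite <- Hrep by exact Hphi; auto).
  (* A test function with the same derivatives of order below [N] as [f] at the jump points: every
     expression pairs equally with both, and its pairing with [phi] is 0. *)
  destruct (exists_jets a b K xi (fun i k => Derive_n f k (xi i)) N Hxi)
    as (phi & Hphi & Hjet).
  rewrite <- (Hpair phi Hphi). unfold delta_sum_pair.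
  rewrite !(delta_sum_RInt_zero a b K N xi s) by auto. f_equal.
  apply delta_terms_pair_jet with K N.
  + apply Hs.
  + intros i Hi. apply Cn_on_diff_near with a b; [exact Hf|].
    assert (H1 := proj2 (proj2 Hxi) 0%nat ltac:(lia)).
    assert (H2 := is_partition_le a b K xi 1 i Hxi ltac:(lia)).
    assert (H3 := is_partition_le a b K xi i K Hxi ltac:(lia)).
    assert (H4 := proj2 (proj2 Hxi) K ltac:(lia)).
    destruct Hxi as (Ha & Hb & _). rewrite Ha in H1; rewrite Hb in H4. lra.
  + intros i _. exact (smooth_diff_near _ _ _ (proj1 Hphi)).
  (* [k <= N - 1] yields [k < N] thanks to [1 <= N]. *)
  + intros i k Hi Hk. symmetry; apply Hjet; [exact Hi|lia].
Qed.
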